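(* Let $E$ be a modular lattice effect algebra and $x\in E$. Then: (i) If $x$ is finite, then for every $y\in E$ the element $(x\vee y)\ominus y$ is finite. (ii) If $x$ is finite, then every $z\in E$ with $z\le x$ is finite. (iii) If $x$ is finite, then every chain in the interval $[0,x]$ is finite. (iv) If $x$ is finite, then $[0,x]$ is a complete lattice. (v) If $x$ and $y\in E$ are finite, then $x\vee y$ is finite. (vi) The set $F$ of all finite elements of $E$ is a lattice ideal of $E$.
   Context: An effect algebra $(E;\oplus,0,1)$ is a set $E$ with two distinct elements $0,1$ and a partially defined binary operation $\oplus$ such that for all $x,y,z\in E$: (Ei) $x\oplus y=y\oplus x$ if $x\oplus y$ is defined; (Eii) $(x\oplus y)\oplus z=x\oplus(y\oplus z)$ if one side is defined; (Eiii) for every $x$ there is a unique $y$, denoted $x'$, with $x\oplus y=1$; (Eiv) if $1\oplus x$ is defined then $x=0$. The partial order is: $x\le y$ iff there is $z$ with $x\oplus z$ defined and $x\oplus z=y$; then $y\ominus x:=z$. $E$ is a lattice effect algebra if $(E,\le)$ is a lattice, and modular if moreover this lattice is modular. An atom is a minimal nonzero element of $E$. An element $u\in E$ is called finite if either $u=0$ or there is a finite sequence $a_1,\dots,a_n$ of not necessarily different atoms of $E$ such that $u=a_1\oplus a_2\oplus\cdots\oplus a_n$. The interval $[0,x]$ is $\{z\in E\mid z\le x\}$ with the induced order. *)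

(* Defs.v *)
From HB Require Import structures.
From mathcomp Require Import all_boot all_order.
From mathcomp Require Import boolp classical_sets functions cardinality.

Set Implicit Arguments.
Unset Strict Implicit.
Unset Printing Implicit Defensive.

Import Order.TTheory.
Local Open Scope classical_set_scope.

(* The partial operation is option-valued, [None] meaning "undefined"; an
   equation between options therefore says that one side is defined iff the
   other is, and that the values then agree. *)
HB.mixin Record isEffectAlgebra E of Choice E := {
  ea0 : E;
  ea1 : E;
  oplus : E -> E -> option E;
  ea0_neq1 : ea0 <> ea1;
  oplusC : forall x y, oplus x y = oplus y x;
  oplusA : forall x y z,
    obind (fun s => oplus s z) (oplus x y) =
    obind (fun t => oplus x t) (oplus y z);
  ea_orthosuppl : forall x, exists! y, oplus x y = Some ea1;
  oplus1_eq0 : forall x, oplus ea1 x <> None -> x = ea0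
}.

#[short(type="effectAlgType")]
HB.structure Definition EffectAlgebra := { E of isEffectAlgebra E & Choice E }.

Definition ea_le (E : effectAlgType) (x y : E) : Prop :=
  exists z, oplus x z = Some y.

(* The lattice order is not additional data: [le_ea] forces it to be [ea_le],
   and joins and meets are determined by the order. *)
HB.mixin Record hasEffectAlgebraOrder d E
    of EffectAlgebra E & Order.Lattice d E := {
  le_ea : forall x y : E, (x <= y)%O <-> ea_le x y
}.

#[short(type="latticeEffectAlgType")]
HB.structure Definition LatticeEffectAlgebra d :=
  { E of hasEffectAlgebraOrder d E & EffectAlgebra E & Order.Lattice d E }.

Definition modular_lattice d (L : latticeType d) : Prop :=
  forall x y z : L, (x <= z)%O ->
    Order.join x (Order.meet y z) = Order.meet (Order.join x y) z.

(* [ominus y x] is y (-) x; the value is [ea0] by default when x <= y fails. *)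
Definition ominus (E : effectAlgType) (y x : E) : E :=
  xget ea0 [set z | oplus x z = Some y].

Lemma ominusP (E : effectAlgType) (x y : E) :
  ea_le x y -> oplus x (ominus y x) = Some y.
Proof. by move=> xy; apply: (@xgetPex _ ea0 [set z | oplus x z = Some y]). Qed.

(* [oplus_seq a [:: b1; ...; bn]] is (...(a (+) b1) (+) ...) (+) bn. *)
Definition oplus_seq (E : effectAlgType) (a : E) (s : seq E) : option E :=
  foldl (fun o b => obind (fun t => oplus t b) o) (Some a) s.

Section LatticeEffectAlgebraDefs.
Context (d : Order.disp_t) (E : latticeEffectAlgType d).
Implicit Types (a u x : E).

Definition ea_atom a : Prop :=
  a <> ea0 /\ forall b : E, b <> ea0 -> (b <= a)%O -> b = a.

Definition ea_finite u : Prop :=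
  u = ea0 \/
  exists (a : E) (s : seq E),
    (forall b, b \in a :: s -> ea_atom b) /\ oplus_seq a s = Some u.

Definition ea_interval x : set E := [set z | (z <= x)%O].

End LatticeEffectAlgebraDefs.

Definition is_chain d (P : porderType d) (C : set P) : Prop :=
  total_on C (fun s t => (s <= t)%O).

(* Bounds are taken inside [L]: suprema and infima are those of the induced
   order on [L], not of the ambient poset. *)
Definition is_complete_lattice d (P : porderType d) (L : set P) : Prop :=
  forall A : set P, A `<=` L ->
    (exists s, (L `&` ubound A) s /\ lbound (L `&` ubound A) s) /\
    (exists i, (L `&` lbound A) i /\ ubound (L `&` lbound A) i).

Definition lattice_ideal d (L : latticeType d) (I : set L) : Prop :=
  [/\ I !=set0,
      forall x y : L, I y -> (x <= y)%O -> I x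
    & forall x y : L, I x -> I y -> I (Order.join x y)].

(* Main.v *)
(* An interval [y, y (+) a] is isomorphic to [0, a], so u is finite iff 0 and u
   are joined by a finite sequence of coverings. By modularity joining or
   meeting such a sequence with a fixed element gives a sequence in which each
   step is again a covering or an equality; this yields (i), (ii), (v), (vi).
   For (iii) and (iv), when v covers u, modularity says that an element of
   [0, v] is determined, among elements comparable to it, by its meet and its
   join with u, and the join takes only the values u and v; so both properties
   pass from [0, u] to [0, v]. *)
Require Import Defs.
From mathcomp Require Import all_boot all_order.
From mathcomp Require Import boolp classical_sets functions cardinality.

Set Implicit Arguments.
Unset Strict Implicit.
Unset Printing Implicit Defensive.

Import Order.TTheory.
Local Open Scope classical_set_scope.

(** * Weak coverings and paths of them in a modular lattice *)

Section ModularLattice.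
Context (d : Order.disp_t) (L : latticeType d).
Implicit Types (x y z u v w : L) (S C : set L).
Local Open Scope order_scope.

(* Weak covering: [u = v] is allowed. *)
Definition wcovers u v : Prop :=
  u <= v /\ forall w, u <= w -> w <= v -> w = u \/ w = v.

Inductive wcover_path y : L -> Prop :=
| wcover_path_refl : wcover_path y y
| wcover_path_step u v : wcover_path y u -> wcovers u v -> wcover_path y v.

Lemma wcover_path_le y u : wcover_path y u -> y <= u.
Proof. by elim=> // {}u v _ yu [uv _]; apply: le_trans uv. Qed.

Lemma wcover_path_trans y u v :
  wcover_path y u -> wcover_path u v -> wcover_path y v.
Proof. by move=> yu; elim=> // w z _ yw wz; apply: wcover_path_step yw wz. Qed.

Context (modL : modular_lattice L).

(** Modularity is the middle step of [x = x ∨ (z ∧ y) = (x ∨ z) ∧ y = y]; the outer steps are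
    absorption after using the two equations. *)
Lemma modular_cancel x y z : x <= y ->
  Order.meet x z = Order.meet y z -> Order.join x z = Order.join y z -> x = y.
Proof.
move=> xy eI eU; have := modL z xy.
by rewrite eU (meetC z y) -eI meetKU meetC joinKI.
Qed.

(** Modularity writes any [t] between the two joins as [w ∨ (v ∧ t)], where [v ∧ t] lies between [u]
    and [v]. *)
Lemma wcovers_joinr w u v :
  wcovers u v -> wcovers (Order.join u w) (Order.join v w).
Proof.
move=> [uv cuv]; split; first by rewrite leU2.
move=> t ut tv.
have ut' : u <= t by apply: le_trans ut; rewrite leUl.
have wt : w <= t by apply: le_trans ut; rewrite leUr.
have tE : t = Order.join w (Order.meet v t).
  by rewrite (modL v wt) (joinC w v); apply/esym/meet_r.
have [e|e] : Order.meet v t = u \/ Order.meet v t = v.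
- by apply: cuv; rewrite ?lexI ?uv ?ut' ?leIl.
- by left; rewrite tE e joinC.
- by right; rewrite tE e joinC.
Qed.

(** Dually, [t = (t ∨ u) ∧ w], where [t ∨ u] lies between [u] and [v]. *)
Lemma wcovers_meetr w u v :
  wcovers u v -> wcovers (Order.meet u w) (Order.meet v w).
Proof.
move=> [uv cuv]; split; first by rewrite leI2.
move=> t ut tv.
have tv' : t <= v by apply: le_trans tv _; rewrite leIl.
have tw : t <= w by apply: le_trans tv _; rewrite leIr.
have tE : t = Order.meet (Order.join t u) w.
  by rewrite -(modL u tw); apply/esym/join_l.
have [e|e] : Order.join t u = u \/ Order.join t u = v.
- by apply: cuv; rewrite ?leUx ?uv ?tv' ?leUr.
- by left; rewrite tE e.
- by right; rewrite tE e.
Qed.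

Lemma wcover_path_joinr w y u :
  wcover_path y u -> wcover_path (Order.join y w) (Order.join u w).
Proof.
elim=> [|{}u v _ yu uv]; first exact: wcover_path_refl.
exact: wcover_path_step yu (wcovers_joinr w uv).
Qed.

Lemma wcover_path_meetr w y u :
  wcover_path y u -> wcover_path (Order.meet y w) (Order.meet u w).
Proof.
elim=> [|{}u v _ yu uv]; first exact: wcover_path_refl.
exact: wcover_path_step yu (wcovers_meetr w uv).
Qed.

Lemma wcovers_joinP u v t :
  wcovers u v -> t <= v -> Order.join t u = u \/ Order.join t u = v.
Proof. by move=> [uv cuv] tv; apply: cuv; rewrite ?leUr // leUx tv uv. Qed.

Lemma wcover_path_chain_finite y x C : wcover_path y x ->
  (forall z, C z -> y <= z <= x) -> is_chain C -> finite_set C.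
Proof.
move=> yx; elim: yx C => [|{}x v yx IH xv] C Cv chC.
  apply: (sub_finite_set _ (finite_set1 y)) => z /Cv /andP[yz zy] /=.
  by apply/le_anti; rewrite yz zy.
(* By [modular_cancel], [f] embeds the chain [C] into a product of two finite sets. *)
pose f z := (Order.meet z x, Order.join z x).
have fI : {in C &, injective f}.
  move=> s t /set_mem Cs /set_mem Ct [eI eU].
  case: (chC s t Cs Ct) => le; first exact: (modular_cancel le eI eU).
  by apply/esym/(modular_cancel le (esym eI) (esym eU)).
rewrite -(eq_finite_set (inj_card_eq fI)).
apply: (@sub_finite_set _ _ (((fun z => Order.meet z x) @` C) `*` [set x; v])).
  move=> _ [z Cz <-]; split=> /=; first by exists z.
  by case/andP: (Cv z Cz) => _; apply: wcovers_joinP.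
apply: finite_setX; last exact: finite_set2.
apply: IH => [_ [z Cz <-]|_ _ [s Cs <-] [t Ct <-]].
  by rewrite leIr lexI (wcover_path_le yx); case/andP: (Cv z Cz) => ->.
by case: (chC s t Cs Ct) => le; [left|right]; rewrite leI2.
Qed.

(** Serves completeness: applied to the upper bounds of a set, it yields the supremum. *)
Lemma wcover_path_least y x S : wcover_path y x ->
  (forall z, S z -> y <= z <= x) -> S !=set0 ->
  (forall s t, S s -> S t -> S (Order.meet s t)) ->
  exists2 m, S m & lbound S m.
Proof.
move=> yx; elim: yx S => [|{}x v yx IH xv] S Sv [s0 Ss0] SI.
  exists s0 => // t St.
  have [/andP[_ sy] /andP[yt _]] := (Sv _ Ss0, Sv _ St).
  exact: le_trans sy yt.
(* If some member is below [x], the least such member [m] bounds all of [S], since each [m ∧ t] is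
   again a member below [x]. *)
have [[s [Ss sx]]|Nx] := pselect (exists s, S s /\ s <= x).
  have [m [Sm mx] mlb] : exists2 m, (S `&` [set t | t <= x]) m &
      lbound (S `&` [set t | t <= x]) m.
    apply: IH.
    - by move=> z [/Sv/andP[-> _] zx].
    - by exists s.
    - move=> a b [Sa ax] [Sb _]; split; first exact: SI.
      exact: le_trans (leIl a b) ax.
  exists m => // t St; apply: le_trans (leIr t m).
  apply: mlb; split; first exact: SI.
  exact: le_trans (leIl m t) mx.
(* Otherwise all joins with [x] equal [v], so comparable members differ only in their meets with
   [x]. *)
have joinE t : S t -> Order.join t x = v.
  move=> St; have /andP[_ tv] := Sv _ St.
  have [e|//] := wcovers_joinP xv tv.
  by exfalso; apply: Nx; exists t; split=> //; rewrite -e leUl.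
have [_ [m Sm <-] mlb] : exists2 m, ((fun z => Order.meet z x) @` S) m &
    lbound ((fun z => Order.meet z x) @` S) m.
  apply: IH.
  - move=> _ [z Sz <-]; rewrite leIr lexI (wcover_path_le yx).
    by case/andP: (Sv z Sz) => ->.
  - by exists (Order.meet s0 x); exists s0.
  - move=> _ _ [s Ss <-] [t St <-]; exists (Order.meet s t); first exact: SI.
    by rewrite meetACA meetxx.
exists m => // t St.
have Smt := SI _ _ Sm St.
(* [m ∧ t] and [m] are comparable, have the same meet with [x] by the choice of [m], and both join
   with [x] to [v]. *)
suff <- : Order.meet m t = m by rewrite leIr.
apply: (@modular_cancel _ _ x); first by rewrite leIl.
  apply/le_anti/andP; split; first by rewrite leI2 // leIl.
  by apply: mlb; exists (Order.meet m t).
by rewrite !joinE.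
Qed.

Lemma wcover_path_complete y x : wcover_path y x ->
  is_complete_lattice [set z : L | y <= z <= x].
Proof.
move=> yx; set I := [set z : L | y <= z <= x].
have le_yx := wcover_path_le yx.
have sup A : A `<=` I ->
    exists s, (I `&` ubound A) s /\ lbound (I `&` ubound A) s.
  move=> AI.
  have [m Sm mlb] : exists2 m, (I `&` ubound A) m & lbound (I `&` ubound A) m.
    apply: (wcover_path_least yx) => [z []//||s t [/andP[ys sx] As] [/andP[yt _] At]].
      (* The top [x] of the interval is an upper bound, even of the empty set. *)
      by exists x; split; [rewrite /I /= le_yx lexx | move=> a /AI /andP[]].
    split; first by rewrite /I /= lexI ys yt (le_trans _ sx) // leIl.
    by move=> a Aa; rewrite lexI As // At.
  by exists m.
move=> A AI; split; first exact: sup.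
(* The infimum of [A] is the supremum of its lower bounds. *)
have [i [[Ii ui] li]] := sup (I `&` lbound A) (@subIsetl _ _ _).
exists i; split=> //; split=> // a Aa.
by apply: li; split; [exact: AI | move=> b [_]; apply].
Qed.

End ModularLattice.

(** * Neutrality of zero and cancellation in an effect algebra *)

Section EffectAlgebra.
Context (E : effectAlgType).
Implicit Types a b c e : E.

Lemma ea_suppl_uniq e a b :
  oplus e a = Some ea1 -> oplus e b = Some ea1 -> a = b.
Proof. by case: (ea_orthosuppl e) => c [_ cU] /cU <- /cU <-. Qed.

Lemma oplus_assocl a b c s r : oplus a b = Some s -> oplus s c = Some r ->
  exists2 t, oplus b c = Some t & oplus a t = Some r.
Proof.
move=> ab sc; have := oplusA a b c; rewrite ab /= sc.
by case: (oplus b c) => //= t at_; exists t.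
Qed.

Lemma oplus_assocr a b c t r : oplus b c = Some t -> oplus a t = Some r ->
  exists2 s, oplus a b = Some s & oplus s c = Some r.
Proof.
move=> bc at_; have := oplusA a b c; rewrite bc /= at_.
by case: (oplus a b) => //= s sc; exists s.
Qed.

(** The supplement of [ea1] is [ea0]; adding it to [b ⊕ a = 1] makes both [a ⊕ 0] and [a]
    supplements of [b]. *)
Lemma oplus0 a : oplus a ea0 = Some a.
Proof.
have [z [z1 _]] := ea_orthosuppl (@ea1 E).
have z0 : z = ea0 by apply: oplus1_eq0; rewrite z1.
rewrite {}z0 in z1.
have [b [ab _]] := ea_orthosuppl a; rewrite oplusC in ab.
have [t at0 bt] := oplus_assocl ab z1.
by rewrite at0 (ea_suppl_uniq bt ab).
Qed.

(** If [e] is the supplement of [s], then [b] and [c] are both supplements of [a ⊕ e]. *)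
Lemma oplus_cancel a b c s :
  oplus a b = Some s -> oplus a c = Some s -> b = c.
Proof.
move=> ab ac; have [e [se _]] := ea_orthosuppl s.
rewrite oplusC in ab; rewrite oplusC in ac.
have [t ae bt] := oplus_assocl ab se.
have [t' ae' ct] := oplus_assocl ac se.
move: ct; rewrite ae in ae'; case: ae' => <- ct.
by rewrite oplusC in bt; rewrite oplusC in ct; apply: ea_suppl_uniq bt ct.
Qed.

Lemma ominusE a b s : oplus a b = Some s -> ominus s a = b.
Proof.
move=> ab; have le_as : ea_le a s by exists b.
exact: oplus_cancel (ominusP le_as) ab.
Qed.

End EffectAlgebra.

(** * Finite elements as endpoints of covering paths from zero *)

Section LatticeEffectAlgebra.
Context (d : Order.disp_t) (E : latticeEffectAlgType d).
Implicit Types a b u v y w : E.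

Lemma ea0_le u : (ea0 <= u)%O.
Proof. by apply/le_ea; exists u; rewrite oplusC oplus0. Qed.

(** An intermediate element is [u ⊕ b], and cancelling [u] gives [b ≤ a], so [b] is [0] or [a]. *)
Lemma wcovers_atom u a v : ea_atom a -> oplus u a = Some v -> wcovers u v.
Proof.
move=> [_ amin] uav; split; first by apply/le_ea; exists a.
move=> w /le_ea[b ub] /le_ea[c wc].
have [t bc ut] := oplus_assocl ub wc.
have ta : t = a by apply: oplus_cancel ut uav.
have [b0|bn0] := eqVneq b ea0.
  by left; move: ub; rewrite b0 oplus0 => -[].
have ba : b = a by apply: amin; [apply/eqP | apply/le_ea; exists c; rewrite -ta].
by right; move: ub; rewrite ba uav => -[].
Qed.

(** A nonzero [b] below the difference [a] places [u ⊕ b] between [u] and [v]; it cannot be [u], so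
    it is [v] and [b = a]. *)
Lemma atom_wcovers u v : wcovers u v ->
  u = v \/ exists2 a, ea_atom a & oplus u a = Some v.
Proof.
move=> [/le_ea[a ua] cuv].
have [->|/eqP uv] := eqVneq u v; [by left | right; exists a => //; split].
  by move=> a0; apply: uv; move: ua; rewrite a0 oplus0 => -[].
move=> b b0 /le_ea[c bc].
have [w ub wc] := oplus_assocr bc ua.
have [wu|wv] : w = u \/ w = v.
- by apply: cuv; apply/le_ea; [exists b | exists c].
- by case: b0; apply: (@oplus_cancel _ u _ _ u); rewrite ?oplus0 // -{2}wu.
- by apply: (@oplus_cancel _ u _ _ v) => //; rewrite -{1}wv.
Qed.

Lemma oplus_seq_rcons a (s : seq E) b :
  oplus_seq a (rcons s b) = obind (fun t => oplus t b) (oplus_seq a s).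
Proof. by rewrite /oplus_seq -cats1 foldl_cat. Qed.

Lemma ea_finite_oplus_atom w a u :
  ea_finite w -> ea_atom a -> oplus w a = Some u -> ea_finite u.
Proof.
move=> [->|[b [s [bs sw]]]] aa wa; right.
  exists a, [::]; split; first by move=> c; rewrite inE => /eqP->.
  by rewrite -wa oplusC oplus0.
exists b, (rcons s a); split; last by rewrite oplus_seq_rcons sw.
by move=> c; rewrite -rcons_cons mem_rcons inE => /orP[/eqP->|/bs].
Qed.

(** Each proper step adds an atom, and associativity collects these atoms into one summand. *)
Lemma wcover_path_oplus y u :
  wcover_path y u -> exists2 w, ea_finite w & oplus y w = Some u.
Proof.
elim=> [|{}u v _ [w fw yw] /atom_wcovers[<-|[a aa ua]]].
- by exists ea0; [left | rewrite oplus0].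
- by exists w.
have [t wa yt] := oplus_assocl yw ua.
by exists t => //; apply: ea_finite_oplus_atom wa.
Qed.

Lemma ea_finiteP u : ea_finite u <-> wcover_path ea0 u.
Proof.
split=> [[->|[a [s]]]|/wcover_path_oplus[w fw]]; first exact: wcover_path_refl.
  (* [oplus_seq] adds on the right, so the last atom gives the last covering. *)
  elim/last_ind: s u => [|s b IH] u [atoms].
    move=> [<-]; apply: wcover_path_step (wcover_path_refl _) _.
    apply: (@wcovers_atom _ a); last by rewrite oplusC oplus0.
    by apply: atoms; rewrite inE.
  rewrite oplus_seq_rcons; case sE: (oplus_seq a s) => [t|] //= tb.
  apply: (@wcover_path_step _ _ _ t).
    apply: IH; split=> // c cs.
    by apply: atoms; rewrite -rcons_cons mem_rcons inE cs orbT.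
  apply: wcovers_atom tb.
  by apply: atoms; rewrite -rcons_cons mem_rcons inE eqxx.
by rewrite oplusC oplus0 => -[<-].
Qed.

Lemma ea_intervalE u : ea_interval u = [set z : E | (ea0 <= z <= u)%O].
Proof. by apply/seteqP; split=> z /=; rewrite /ea_interval /= ea0_le. Qed.

Context (modE : modular_lattice E).

(** The path from [0] to [u] is joined with [y], and [0 ∨ y = y]. *)
Lemma wcover_path_join u y : ea_finite u -> wcover_path y (Order.join u y).
Proof.
by move=> /ea_finiteP/(wcover_path_joinr modE y); rewrite (join_r (ea0_le y)).
Qed.

Lemma ea_finite_ominus_join u y :
  ea_finite u -> ea_finite (ominus (Order.join u y) y).
Proof.
move=> /(wcover_path_join y)/wcover_path_oplus[w fw yw].
by rewrite (ominusE yw).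
Qed.

(** Meeting the path from [0] to [u] with [v] leaves a path from [0] to [u ∧ v = v]. *)
Lemma ea_finite_le u v : ea_finite u -> (v <= u)%O -> ea_finite v.
Proof.
move=> /ea_finiteP/(wcover_path_meetr modE v); rewrite (meet_l (ea0_le v)).
by move=> uv vu; apply/ea_finiteP; rewrite (meet_r vu) in uv.
Qed.

Lemma ea_finite_join u v :
  ea_finite u -> ea_finite v -> ea_finite (Order.join u v).
Proof.
move=> fu /ea_finiteP fv; apply/ea_finiteP.
(* The path runs from [0] to [v], then from [v] to [u ∨ v]. *)
exact: wcover_path_trans fv (wcover_path_join v fu).
Qed.

End LatticeEffectAlgebra.

Theorem theorem1 (d : Order.disp_t) (E : latticeEffectAlgType d)
    (modE : modular_lattice E) (x : E) :
  (ea_finite x -> forall y : E, ea_finite (ominus (Order.join x y) y)) /\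
  (ea_finite x -> forall z : E, (z <= x)%O -> ea_finite z) /\
  (ea_finite x ->
     forall C : set E, C `<=` ea_interval x -> is_chain C -> finite_set C) /\
  (ea_finite x -> is_complete_lattice (ea_interval x)) /\
  (forall y : E, ea_finite x -> ea_finite y -> ea_finite (Order.join x y)) /\
  lattice_ideal [set u : E | ea_finite u].
Proof.
split; first by move=> fx y; apply: ea_finite_ominus_join.
split; first by move=> fx z; apply: ea_finite_le.
split.
  move=> /ea_finiteP fx C; rewrite ea_intervalE => Cx.
  exact: (wcover_path_chain_finite modE fx Cx).
split.
  by move=> /ea_finiteP fx; rewrite ea_intervalE; apply: wcover_path_complete.
split; first by move=> y; apply: ea_finite_join.
split; first by exists ea0; left.
- by move=> u v /= fv; apply: ea_finite_le.
- by move=> u v /=; apply: ea_finite_join.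
Qed.
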